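(* Let $G$ be a finite non-abelian group all of whose proper subgroups are abelian, and suppose $|G|=p^\alpha$ for some prime $p$ and positive integer $\alpha$. Then the nim-value of the avoidance game on $G$ is \[DNG(G)=\begin{cases} *0, & p=2,\\ *1, & p\ne 2.\end{cases}\]
   Context: The avoidance game $DNG(G)$ on a finite non-trivial group $G$: two players alternately choose a not-yet-chosen element of $G$ in such a way that the set of jointly chosen elements does not generate $G$. A player who cannot make such a choice loses (the player making the last move wins). A position is the set of jointly chosen elements (a non-generating subset of $G$); the starting position is $\emptyset$. The options $Opt(P)$ of a position $P$ are the sets $P\cup\{g\}$ with $g\in G\setminus P$ and $\langle P\cup\{g\}\rangle\neq G$. The nim-value is defined recursively by $nim(P)=mex\{nim(Q): Q\in Opt(P)\}$, where $mex(A)$ is the smallest non-negative integer not in $A$. The nim-value of the game is $nim(\emptyset)$, and $DNG(G)=*k$ means that it equals $k$. *)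

(* Defs.v *)
From mathcomp Require Import all_boot all_fingroup.

Set Implicit Arguments.
Unset Strict Implicit.
Unset Printing Implicit Defensive.

Lemma mex_subproof (s : seq nat) : exists n, n \notin s.
Proof.
exists (\max_(i <- s) i).+1; apply/negP => s_max.
by have := @leq_bigmax_seq _ s xpredT id _ s_max isT; rewrite ltnn.
Qed.

Definition mex (s : seq nat) : nat := ex_minn (mex_subproof s).

Section AvoidanceGame.

Variables (gT : finGroupType) (G : {group gT}).
Implicit Types P Q : {set gT}.

Definition Opt P : {set {set gT}} :=
  [set g |: P | g in G :\: P & <<g |: P>>%g != G].

(* Each move removes one element from G :\: P, so #|G :\: P| levels of
   recursion reach every terminal position; nimE below is the recursive
   equation that characterizes nim. *)
Fixpoint nim_rec (n : nat) P : nat :=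
  if n is n'.+1 then mex [seq nim_rec n' Q | Q in Opt P] else 0.

Definition nim P : nat := nim_rec #|G :\: P| P.

Lemma card_Opt P Q : Q \in Opt P -> #|G :\: P| = #|G :\: Q|.+1.
Proof.
case/imsetP=> g; rewrite inE => /andP[GPg _] ->.
by rewrite (cardsD1 g) GPg setDDl setUC.
Qed.

Lemma nimE P : nim P = mex [seq nim Q | Q in Opt P].
Proof.
rewrite /nim; case cGP: #|G :\: P| => [|n] /=.
  rewrite /mex; case: ex_minnP => m _ /(_ 0) m_min.
  apply/esym/eqP; rewrite -leqn0 m_min //.
  by apply/imageP=> -[Q /card_Opt]; rewrite cGP.
congr mex; apply/eq_in_map => Q; rewrite mem_enum => /card_Opt.
by rewrite cGP => -[->].
Qed.

Definition DNG : nat := nim set0.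

End AvoidanceGame.

(* Main.v *)
(** Every play exhausts a proper subgroup that is a terminal position.  If all
    these subgroups have orders of the same parity, the parity of a position
    determines who makes the last move, so nim-values alternate between 0 and 1.
    In a p-group with p odd every subgroup has odd order; in a non-abelian
    2-group the only subgroup of odd order, the trivial one, is not terminal
    because the group is not cyclic. *)
Require Import Defs.
From mathcomp Require Import all_boot all_fingroup.
From mathcomp Require Import pgroup.

Set Implicit Arguments.
Unset Strict Implicit.
Unset Printing Implicit Defensive.

Lemma mexP (s : seq nat) (m : nat) :
  m \notin s -> (forall i, i < m -> i \in s) -> mex s = m.
Proof.
move=> sm s_lt; rewrite /mex; case: ex_minnP => n sn n_min.
apply/eqP; rewrite eqn_leq n_min //= leqNgt.
by apply: contra sn; apply: s_lt.
Qed.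

Section Parity.

Variables (gT : finGroupType) (G : {group gT}).
Implicit Types P Q : {set gT}.

Lemma OptP P Q :
  reflect (exists g, [/\ g \in G, g \notin P, <<g |: P>>%g != G & Q = g |: P])
          (Q \in Opt G P).
Proof.
apply: (iffP imsetP) => [[g]|[g [Gg Pg ntP ->]]].
  by rewrite !inE => /andP[/andP[Pg Gg] ntP] ->; exists g.
by exists g; rewrite // !inE Pg Gg.
Qed.

(** An element of [<<P>>] outside [P] could be added without enlarging the generated subgroup, hence
    would be a legal move. *)
Lemma terminal_gen P :
  P \subset G -> <<P>>%g != G -> Opt G P = set0 -> <<P>>%g = P.
Proof.
move=> sPG ntP Opt0; apply/eqP; rewrite eqEsubset subset_gen andbT.
apply/subsetP => g gP; apply/negPn/negP => Pg.
have: g |: P \in Opt G P.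
  apply/OptP; exists g; split=> //.
    by move: gP; apply/subsetP; rewrite gen_subG.
  suff -> : <<g |: P>>%g = <<P>>%g by [].
  apply/eqP; rewrite eqEsubset gen_subG subUset sub1set gP subset_gen.
  by rewrite genS ?subsetUr.
by rewrite Opt0 inE.
Qed.

(** Induction on the number of unchosen elements: a move flips the parity of [#|P|], so all options
    share one value, the opposite of the claimed one. *)
Lemma nim_parity (r : bool) :
  (forall K : {group gT}, K \proper G -> Opt G K = set0 -> odd #|K| = r) ->
  forall P, P \subset G -> <<P>>%g != G -> nim G P = odd #|P| (+) r.
Proof.
move=> term_r P; move: {2}#|_| (leqnn #|G :\: P|) => n.
elim: n P => [|n IHn] P leGPn sPG ntP.
  by case/eqP: ntP; rewrite (_ : P = G) ?genGid //; apply/eqP;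
     rewrite eqEsubset sPG -setD_eq0 -cards_eq0 -leqn0.
have nimQ Q : Q \in Opt G P -> nim G Q = ~~ (odd #|P| (+) r).
  move=> OptQ; have := card_Opt OptQ; case/OptP: OptQ => g [Gg Pg ntQ ->] cGP.
  rewrite IHn ?cardsU1 ?Pg ?addNb //; first by rewrite -ltnS -cGP.
  by rewrite subUset sub1set Gg.
rewrite nimE; apply: mexP => [|i].
  by apply/imageP => -[Q /nimQ ->]; case: (_ (+) _).
case parP: (odd #|P| (+) r) => //; case: i => // _.
(* Value 1 needs an option of value 0. Without options, [P] would be a terminal subgroup of parity
   [r], against [parP]. *)
have [Opt0 | [Q OptQ]] := set_0Vmem (Opt G P).
  have genP := terminal_gen sPG ntP Opt0.
  have:= term_r <<P>>%G; rewrite /= genP properEneq sPG -{1}genP ntP.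
  by move=> /(_ isT Opt0) oddP; rewrite oddP addbb in parP.
by apply/imageP; exists Q; rewrite ?nimQ // parP.
Qed.

End Parity.

Theorem proposition4p6 (gT : finGroupType) (G : {group gT}) (p alpha : nat)
    (G_nonabelian : ~~ abelian G)
    (proper_abelian : forall H : {group gT}, H \proper G -> abelian H)
    (p_prime : prime p) (alpha_gt0 : 0 < alpha)
    (card_G : #|G| = p ^ alpha) :
  DNG G = (if p == 2 then 0 else 1).
Proof.
have pG : (p.-group G)%g by rewrite /pgroup card_G pnatX pnat_id.
have ntG : <<set0>>%g != G.
  by apply: contra G_nonabelian; rewrite gen0 => /eqP <-; apply: abelian1.
(* The empty position has even size, so its value is [r] itself. *)
rewrite /DNG (nim_parity (r := p != 2)) ?sub0set ?cards0 //; first by case: eqP.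
move=> K /proper_sub sKG Opt0; have pK := pgroupS sKG pG.
have [p2 | p_n2] := eqVneq p 2; last first.
  by apply: odd_pgroup_odd pK; apply: contraNT p_n2 => /(prime_oddPn p_prime)/eqP.
have [K1 | ntK] := eqVneq K 1%G; last first.
  have [_ + _] := pgroup_pdiv pK ntK.
  by rewrite p2 dvdn2 => /negbTE.
have /trivgPn[g Gg ntg] : G :!=: 1%g by rewrite eq_sym -gen0.
have: g |: K \in Opt G K.
  apply/OptP; exists g; rewrite K1 inE; split=> //.
  apply: contra G_nonabelian => /eqP <-.
  (* The set [g |: 1] generates the cyclic group [<[g]>], which is abelian and so differs from
     [G]. *)
  by rewrite -[<<_>>%g]/([set g] <*> 1)%g -joing_idl joingG1 cycle_abelian.
by rewrite Opt0 inE.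
Qed.
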